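(* Assume the discount function satisfies $\delta(t+s)\ge\delta(t)\delta(s)$ for all $s,t\in\mathbb N$. Let $f\ge0$ be a bounded reward function and $Q$ a transition kernel on $\mathbb X$. Then $$S_*(f,Q)=S^*(f,Q)\qquad\text{and}\qquad W^Q(x,f)=J^Q(x,S_*(f,Q),f)=V^Q(x,f),\quad\forall x\in\mathbb X.$$
   Context: $\mathbb X$ is a Polish space with Borel $\sigma$-algebra $\mathcal B$; $\mathbb N=\{0,1,2,\dots\}$. $X=(X_t)_{t\in\mathbb N}$ is a time-homogeneous discrete-time Markov process with values in $\mathbb X$. For a transition kernel $Q$ on $\mathbb X$, $\mathbb E^Q_x$ is the expectation when $X$ has transition kernel $Q$ and $X_0=x$. The discount function $\delta:\mathbb N\to[0,1]$ is fixed, decreasing (in the weak sense), with $\delta(0)=1$, $\delta(1)<1$, $\lim_{t\to\infty}\delta(t)=0$. A reward function is a Borel function $f:\mathbb X\to[0,\infty)$. Convention: $\delta(\tau)f(X_\tau)=0$ on $\{\tau=\infty\}$. For $S\in\mathcal B$ let $\rho(S)=\inf\{t\ge1: X_t\in S\}$ ($\inf\emptyset=\infty$) and $J^Q(x,S,f)=\mathbb E^Q_x[\delta(\rho(S))f(X_{\rho(S)})]$ if $x\notin S$, $J^Q(x,S,f)=f(x)$ if $x\in S$. $S\in\mathcal B$ is an equilibrium (w.r.t. $f,Q$) if $f(x)\le\mathbb E^Q_x[\delta(\rho(S))f(X_{\rho(S)})]$ for all $x\notin S$ and $f(x)\ge\mathbb E^Q_x[\delta(\rho(S))f(X_{\rho(S)})]$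 for all $x\in S$; it is a pseudo equilibrium if only the first condition (for all $x\notin S$) is required. $\mathcal E^Q(f)$ and $\mathcal G^Q(f)$ are the sets of equilibria and of pseudo equilibria. Put $V^Q(x,f)=\sup_{S\in\mathcal E^Q(f)}J^Q(x,S,f)$, $W^Q(x,f)=\sup_{S\in\mathcal G^Q(f)}J^Q(x,S,f)$, $S^*(f,Q)=\bigcap_{S\in\mathcal E^Q(f)}S$ and $S_*(f,Q)=\bigcap_{S\in\mathcal G^Q(f)}S$. *)

(* Defs.v *)
From mathcomp Require Import all_boot all_order all_algebra.
From mathcomp Require Import all_classical all_reals all_analysis.

Set Implicit Arguments.
Unset Strict Implicit.
Unset Printing Implicit Defensive.

Import Order.TTheory GRing.Theory Num.Theory.
Import numFieldNormedType.Exports.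

Local Open Scope classical_set_scope.
Local Open Scope ring_scope.

(* Separable and completely metrizable; no metric is singled out. *)
Definition polish (R : realType) (T : topologicalType) : Prop :=
  (exists2 D : set T, countable D & dense D) /\
  exists m : T -> T -> R,
    [/\ forall x y, m x y = 0 <-> x = y,
        forall x y, m x y = m y x,
        forall x y z, m x z <= m x y + m y z,
        forall (x : T) (A : set T),
          nbhs x A <-> exists2 e, 0 < e & [set y | m x y < e] `<=` A
      & forall u : nat -> T,
          (forall e, 0 < e -> exists N : nat, forall i j : nat,
             (N <= i)%N -> (N <= j)%N -> m (u i) (u j) < e) ->
          exists l : T, u @ \oo --> l].

Notation borelType T := (g_sigma_algebraType (@open T)).

Definition discount_function (R : realType) (delta : nat -> R) : Prop :=
  [/\ forall t, 0 <= delta t <= 1,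
      {homo delta : s t / (s <= t)%N >-> t <= s},
      delta 0%N = 1, delta 1%N < 1
    & delta t @[t --> \oo] --> (0 : R)].

Definition bounded_reward (R : realType) d (E : measurableType d)
    (f : E -> R) : Prop :=
  [/\ measurable_fun setT f, forall x, 0 <= f x
    & exists M, forall x, f x <= M].

Section process.
Context {R : realType} {d d' : measure_display}.
Context {Omega : measurableType d'} {E : measurableType d}.
Implicit Types (P : E -> probability Omega R) (X : nat -> Omega -> E).
Implicit Types (delta : nat -> R) (f : E -> R) (S : set E) (x : E).

Definition natural_filtration X (t : nat) : set (set Omega) :=
  <<s \bigcup_(s in [set s | (s <= t)%N])
        preimage_set_system setT (X s) measurable >>.

(* Under every [P x], X starts at x and is Markov with kernel Q: the last
   clause says that [Q (X t) B] is a version of the conditional probability of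
   [X t.+1 \in B] given the natural filtration at time t. *)
Definition markov_family (Q : R.-pker E ~> E) P X : Prop :=
  (forall t, measurable_fun setT (X t)) /\
  forall x,
    {ae P x, forall w, X 0%N w = x} /\
    forall (t : nat) (A : set Omega) (B : set E),
      natural_filtration X t A -> measurable B ->
      P x (A `&` X t.+1 @^-1` B) = (\int[P x]_(w in A) Q (X t w) B)%E.

(* [None] is the value +oo. *)
Definition rho X S (w : Omega) : option nat :=
  if pselect (exists t, (0 < t)%N && (X t w \in S)) is left h
  then Some (ex_minn h) else None.

Definition discounted_reward X delta f S (w : Omega) : R :=
  if rho X S w is Some t then delta t * f (X t w) else 0.

Definition continuation_value P X delta f S x : \bar R :=
  'E_(P x)[discounted_reward X delta f S].

Definition J P X delta x S f : \bar R :=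
  if x \in S then (f x)%:E else continuation_value P X delta f S x.

Definition pseudo_equilibria P X delta f : set (set E) :=
  [set S | measurable S /\
    forall x, ~ S x -> ((f x)%:E <= continuation_value P X delta f S x)%E].

Definition equilibria P X delta f : set (set E) :=
  [set S | [/\ measurable S,
    forall x, ~ S x -> ((f x)%:E <= continuation_value P X delta f S x)%E
    & forall x, S x -> (continuation_value P X delta f S x <= (f x)%:E)%E]].

Definition V P X delta x f : \bar R :=
  ereal_sup [set J P X delta x S f | S in equilibria P X delta f].

Definition W P X delta x f : \bar R :=
  ereal_sup [set J P X delta x S f | S in pseudo_equilibria P X delta f].

Definition equilibria_cap P X delta f : set E :=
  \bigcap_(S in equilibria P X delta f) S.

Definition pseudo_equilibria_cap P X delta f : set E :=
  \bigcap_(S in pseudo_equilibria P X delta f) S.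

End process.

(* Main.v *)
Require Import Defs.
From mathcomp Require Import all_boot all_order all_algebra.
From mathcomp Require Import all_classical all_reals all_analysis.
From mathcomp Require Import measurable_realfun.
Import Order.TTheory GRing.Theory Num.Theory.
Import numFieldNormedType.Exports.
Set Implicit Arguments.
Unset Strict Implicit.
Unset Printing Implicit Defensive.
Local Open Scope classical_set_scope.
Local Open Scope ring_scope.

(** Everything is compared with a set built from below. Put [S_0 = set0] and
    let [w_0(s, x) = M * delta s] bound every reward collected from time [s] on.
    Given [S_n] and [w_n], let [w_(n+1)(s, x)] be [delta s * f x] on [S_n] and
    the larger of [delta s * f x] and [Q w_n(s+1, .) x] elsewhere, and let
    [S_(n+1)] add to [S_n] the points where [f > Q w_n(1, .)]. The [S_n]
    increase, the [w_n] decrease, and [w_n(1, .)] dominates the reward of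
    stopping no later than the first visit to [S_(n-1)]. Hence each [S_n] lies
    in every pseudo equilibrium, and so does the union [L] of the [S_n], which
    is measurable. If [v = inf w_n], then off [L] one has [f <= Q v(1, .)], and
    supermultiplicativity of [delta] turns this into [v(s, .) <= Q v(s+1, .)];
    iterating until [L] is hit, [v] is at most the value of waiting for [L].
    This makes [L] an equilibrium, so both intersections equal [L], and the
    same comparison shows that no larger set has a bigger value than [L]. *)

(** * Integrals of decreasing sequences of functions *)

Section decreasing_integrals.
Local Open Scope ereal_scope.
Context {R : realType} {d : measure_display} {E : measurableType d}.

Lemma nonincreasing_cvg_ereal_inf (u : nat -> \bar R) :
  (forall n, u n.+1 <= u n) -> u @ \oo --> ereal_inf (range u).
Proof.
by move=> du; apply: ereal_nonincreasing_cvgn; exact/nonincreasing_seqP.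
Qed.

Lemma measurable_ereal_inf (g : nat -> E -> \bar R) :
  (forall n, measurable_fun setT (g n)) ->
  (forall n y, g n.+1 y <= g n y) ->
  measurable_fun setT (fun y => ereal_inf (range (g ^~ y))).
Proof.
move=> mg dg; apply: emeasurable_fun_cvg mg _ => y _.
exact: nonincreasing_cvg_ereal_inf.
Qed.

(** Dominated convergence: on a finite measure the constant [K] is an integrable majorant, so the
    integrals of [g n] converge to that of the infimum and a lower bound common to all of them
    survives. *)
Lemma le_integral_ereal_inf (mu : {measure set E -> \bar R})
    (g : nat -> E -> \bar R) (K : R) (c : \bar R) :
  mu setT < +oo ->
  (forall n, measurable_fun setT (g n)) ->
  (forall n y, 0 <= g n y <= K%:E) ->
  (forall n y, g n.+1 y <= g n y) ->
  (forall n, c <= \int[mu]_y g n y) ->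
  c <= \int[mu]_y ereal_inf (range (g ^~ y)).
Proof.
move=> mufin mg bg dg cg.
have iK : mu.-integrable setT (cst K%:E).
  apply/integrableP; split; first exact: measurable_cst.
  by rewrite /= (integral_cst mu measurableT) lte_mul_pinfty.
have bgK y n : `|g n y| <= K%:E.
  by case/andP: (bg n y) => g0; rewrite gee0_abs.
have [_ _ cvgI] := @dominated_convergence _ _ _ mu setT measurableT g
  (fun y => ereal_inf (range (g ^~ y))) (cst K%:E) mg
  (measurable_ereal_inf mg dg)
  (aeW _ (fun y _ => nonincreasing_cvg_ereal_inf (dg ^~ y)))
  iK
  (aeW _ (fun y n _ => bgK y n)).
rewrite -(cvg_lim _ cvgI)//; apply: lime_ge; first by apply/cvg_ex; eexists; exact: cvgI.
exact: nearW.
Qed.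

End decreasing_integrals.

Lemma measurable_fun_in_set d (E : measurableType d) (S : set E) :
  measurable S -> measurable_fun setT (fun x => x \in S).
Proof.
move=> mS; apply: (measurable_fun_bool true); rewrite setTI.
by rewrite (_ : _ @^-1` _ = S)//; apply/seteqP; split=> x; [exact: set_mem|exact: mem_set].
Qed.

(** * Iterated stopping values and regions, computed from the kernel alone *)

Section stopping_values.
Local Open Scope ereal_scope.
Context {R : realType} {d : measure_display} {E : measurableType d}.
Variables (Q : R.-pker E ~> E) (delta : nat -> R) (f : E -> R) (M : R).
Hypothesis delta_discount : discount_function delta.
Hypothesis delta_supermul :
  forall s t : nat, (delta s * delta t <= delta (t + s)%N)%R.
Hypothesis mf : measurable_fun setT f.
Hypothesis f0 : forall x, (0 <= f x)%R.
Hypothesis fM : forall x, (f x <= M)%R.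
Hypothesis M0 : (0 <= M)%R.

Definition payoff (s : nat) (x : E) : \bar R := (delta s * f x)%:E.

(* Value at time [s] of waiting for [S], truncated after [n] steps at the upper
   bound [M * delta], so that it decreases to the true value as [n] grows. *)
Fixpoint hitting_value (n : nat) (S : set E) (s : nat) (x : E) : \bar R :=
  if n is m.+1 then
    if x \in S then payoff s x else \int[Q x]_y hitting_value m S s.+1 y
  else (M * delta s)%:E.

(* The pair (S_n, w_n) of the header. *)
Fixpoint stage (n : nat) : set E * (nat -> E -> \bar R) :=
  if n is m.+1 then
    ((stage m).1 `|` [set x | \int[Q x]_y (stage m).2 1%N y < (f x)%:E],
     fun s x => if x \in (stage m).1 then payoff s x
                else maxe (payoff s x) (\int[Q x]_y (stage m).2 s.+1 y))
  else (set0, fun s _ => (M * delta s)%:E).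

Definition stage_set n := (stage n).1.
Definition stage_value n := (stage n).2.
Definition limit_set : set E := \bigcup_n stage_set n.
Definition limit_value s x := ereal_inf (range (fun n => stage_value n s x)).

Lemma stage_setS n : stage_set n.+1 =
  stage_set n `|` [set x | \int[Q x]_y stage_value n 1 y < (f x)%:E].
Proof. by []. Qed.

Lemma stage_valueS n s x : stage_value n.+1 s x =
  if x \in stage_set n then payoff s x
  else maxe (payoff s x) (\int[Q x]_y stage_value n s.+1 y).
Proof. by []. Qed.

Lemma delta_ge0 s : (0 <= delta s)%R.
Proof. by case: delta_discount => /(_ s)/andP[]. Qed.

Lemma le_delta s : (delta s.+1 <= delta s)%R.
Proof. by case: delta_discount => _ + _ _ _; apply. Qed.

Lemma measurable_payoff s : measurable_fun setT (payoff s).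
Proof. by apply/measurable_EFinP; exact: measurable_funM. Qed.

Lemma payoff_bound s x : 0 <= payoff s x <= (M * delta s)%:E.
Proof.
by rewrite !lee_fin mulr_ge0 ?delta_ge0//= mulrC ler_wpM2r ?delta_ge0.
Qed.

Lemma measurable_kernel_integral (g : E -> \bar R) :
  measurable_fun setT g -> (forall y, 0 <= g y) ->
  measurable_fun setT (fun x => \int[Q x]_y g y).
Proof.
move=> mg g0; apply: measurable_fun_integral_kernel => // U mU.
exact: measurable_kernel.
Qed.

(** [Q x] has mass one and [delta] decreases, so averaging a function bounded at time [s.+1]
    respects the bound for time [s]. This carries the bound [M * delta s] through both
    recursions. *)
Lemma kernel_integral_bound (g : E -> \bar R) s x :
  measurable_fun setT g -> (forall y, 0 <= g y <= (M * delta s.+1)%:E) ->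
  0 <= \int[Q x]_y g y <= (M * delta s)%:E.
Proof.
move=> mg bg; apply/andP; split.
  by apply: integral_ge0 => y _; case/andP: (bg y).
apply: (@le_trans _ _ (\int[Q x]_y cst (M * delta s.+1)%:E y)).
  apply: ge0_le_integral => //; first by move=> y _; case/andP: (bg y).
  by move=> y _; case/andP: (bg y).
rewrite integral_cst// prob_kernel mule1 lee_fin.
by rewrite ler_wpM2l// le_delta.
Qed.

Lemma hitting_value_regular n S s : measurable S ->
  measurable_fun setT (hitting_value n S s) /\
  forall x, 0 <= hitting_value n S s x <= (M * delta s)%:E.
Proof.
move=> mS; elim: n s => [|n IH] s /=.
  by split=> [|x]; [exact: measurable_cst|
    rewrite lee_fin mulr_ge0 ?delta_ge0/=].
have [mh bh] := IH s.+1; split=> [|x].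
  apply: measurable_fun_ifT.
  - exact: measurable_fun_in_set.
  - exact: measurable_payoff.
  - by apply: measurable_kernel_integral => // y; case/andP: (bh y).
by case: ifP => _; [exact: payoff_bound|exact: kernel_integral_bound].
Qed.

(** The claims go through one induction: each new set is cut out by the previous value, each new
    value branches on the previous set, and measurability of a kernel integral uses nonnegativity of
    the integrand. *)
Lemma stage_regular n : measurable (stage_set n) /\
  forall s, measurable_fun setT (stage_value n s) /\
    forall x, 0 <= stage_value n s x <= (M * delta s)%:E.
Proof.
elim: n => [|n [mS IH]].
  split; first exact: measurable0.
  move=> s; split=> [|x]; first exact: measurable_cst.
  by rewrite /stage_value/= lee_fin mulr_ge0 ?delta_ge0/=.
have mI s : measurable_fun setT (fun x => \int[Q x]_y stage_value n s y).
  have [mh bh] := IH s.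
  by apply: measurable_kernel_integral => // y; case/andP: (bh y).
split=> [|s].
  apply: measurableU => //; rewrite -[X in measurable X]setTI.
  by apply: measurable_lte => //; [exact: (mI 1%N)|exact/measurable_EFinP].
have [mh bh] := IH s.+1; split=> [|x].
  apply: measurable_fun_ifT.
  - exact: measurable_fun_in_set.
  - exact: measurable_payoff.
  - by apply: measurable_maxe; [exact: measurable_payoff|exact: (mI s.+1)].
have /andP[p0 pM] := payoff_bound s x.
have /andP[q0 qM] := kernel_integral_bound x mh bh.
rewrite stage_valueS; case: ifP => _; first by rewrite p0.
by rewrite le_max p0/= ge_max pM.
Qed.

Lemma measurable_limit_set : measurable limit_set.
Proof.
by apply: bigcupT_measurable => n; case: (stage_regular n).
Qed.

Lemma le_kernel_integral (g h : E -> \bar R) x :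
  measurable_fun setT g -> measurable_fun setT h -> (forall y, 0 <= g y) ->
  (forall y, g y <= h y) -> \int[Q x]_y g y <= \int[Q x]_y h y.
Proof. by move=> mg mh g0 gh; exact: ge0_le_integral. Qed.

Lemma le_stage_integral m n s t x :
  (forall y, stage_value m s y <= stage_value n t y) ->
  \int[Q x]_y stage_value m s y <= \int[Q x]_y stage_value n t y.
Proof.
have [_ /(_ s)[ms bs]] := stage_regular m.
have [_ /(_ t)[mt _]] := stage_regular n.
by apply: le_kernel_integral => // y; case/andP: (bs y).
Qed.

(** The first step is the a priori bound. Later, a point of the larger stopping set gets only its
    payoff, which both branches of the preceding value dominate; outside it both values are maxima
    and the integrals compare by induction. *)
Lemma stage_value_decreasing n s x :
  stage_value n.+1 s x <= stage_value n s x.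
Proof.
elim: n s x => [|n IH] s x.
  have [_ /(_ s)[_ bs]] := stage_regular 1.
  by case/andP: (bs x).
rewrite !stage_valueS.
case: ifPn => [_|xS]; first by case: ifP => _ //; rewrite le_max lexx.
rewrite ifN; last first.
  by apply: contra xS; rewrite !inE => xS; left.
rewrite ge_max !le_max lexx/=; apply/orP; right.
by apply: le_stage_integral => y; exact: IH.
Qed.

(** The stage sets do not depend on time, so both sides take the same branch; supermultiplicativity
    of [delta] handles the payoff and the initial bound, and scaling by [delta s] commutes with
    maximum and integral. *)
Lemma stage_value_supermul n s t x :
  (delta s)%:E * stage_value n t x <= stage_value n (t + s) x.
Proof.
elim: n s t x => [|n IH] s t x.
  by rewrite /stage_value/= -EFinM lee_fin mulrCA ler_wpM2l.
have pp : (delta s)%:E * payoff t x <= payoff (t + s) x.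
  by rewrite /payoff -EFinM lee_fin mulrA ler_wpM2r.
rewrite !stage_valueS; case: ifP => _ //.
rewrite maxeMr ?lee_fin ?delta_ge0// ge_max !le_max pp/=.
apply/orP; right.
have [_ r] := stage_regular n.
have [mt bt] := r t.+1; have [mts bts] := r (t.+1 + s)%N.
rewrite -ge0_integralZl_EFin ?delta_ge0//; last first.
  by move=> y _; case/andP: (bt y).
apply: le_kernel_integral => // [|y]; first exact: measurable_funeM.
by rewrite mule_ge0 ?lee_fin ?delta_ge0//; case/andP: (bt y).
Qed.

Lemma limit_value_le n s x : limit_value s x <= stage_value n s x.
Proof. by apply: ereal_inf_lbound; exists n. Qed.

Lemma limit_value_ge0 s x : 0 <= limit_value s x.
Proof.
apply: le_ereal_inf_tmp => _ [n _ <-].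
by have [_ /(_ s)[_ bs]] := stage_regular n; case/andP: (bs x).
Qed.

Lemma le_limit_value_integral s x (c : \bar R) :
  (forall n, c <= \int[Q x]_y stage_value n s y) ->
  c <= \int[Q x]_y limit_value s y.
Proof.
move=> cn.
apply: (@le_integral_ereal_inf _ _ _ (Q x) (stage_value ^~ s) (M * delta s)).
- by rewrite prob_kernel ltry.
- by move=> n; have [_ /(_ s)[]] := stage_regular n.
- by move=> n; have [_ /(_ s)[]] := stage_regular n.
- by move=> n y; exact: stage_value_decreasing.
- exact: cn.
Qed.

Lemma measurable_limit_value s : measurable_fun setT (limit_value s).
Proof.
apply: measurable_ereal_inf => n; last exact: stage_value_decreasing.
by have [_ /(_ s)[]] := stage_regular n.
Qed.

Lemma notin_limit_set n x : ~ limit_set x -> ~ stage_set n x.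
Proof. by move=> xS xSn; apply: xS; exists n. Qed.

(** Were the inequality to fail, [x] would have been added to [stage_set n.+1]. *)
Lemma le_stage_integral1 n x : ~ limit_set x ->
  (f x)%:E <= \int[Q x]_y stage_value n 1 y.
Proof.
move=> xS; rewrite leNgt; apply/negP => lt.
by apply: xS; exists n.+1 => //; right.
Qed.

(* By supermultiplicativity continuing at time [s] is worth at least [delta s]
   times continuing at time 0, hence at least [delta s * f]: stopping never
   beats continuing. *)
Lemma limit_value_le_integral s x : ~ limit_set x ->
  limit_value s x <= \int[Q x]_y limit_value s.+1 y.
Proof.
move=> xS; apply: le_limit_value_integral => n.
apply: le_trans (limit_value_le n.+1 s x) _.
rewrite stage_valueS ifN; last first.
  by apply/negP; rewrite inE; exact: notin_limit_set.
rewrite ge_max lexx andbT.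
have [_ r] := stage_regular n.
have [m1 b1] := r 1%N; have [ms bs] := r s.+1.
rewrite /payoff EFinM.
apply: le_trans (lee_wpmul2l _ (le_stage_integral1 n xS)) _.
  by rewrite lee_fin delta_ge0.
rewrite -ge0_integralZl_EFin ?delta_ge0//; last first.
  by move=> y _; case/andP: (b1 y).
apply: le_kernel_integral => // [|y|y]; first exact: measurable_funeM.
- by rewrite mule_ge0 ?lee_fin ?delta_ge0//; case/andP: (b1 y).
- exact: stage_value_supermul 1%N y.
Qed.

Lemma limit_value_le_hitting n s x :
  limit_value s x <= hitting_value n limit_set s x.
Proof.
elim: n s x => [|n IH] s x; first exact: (limit_value_le 0%N s x).
rewrite /=; case: ifPn => [|xS].
  (* If [x] lies in stage set [m], the value of index [m.+1] is exactly the payoff there. *)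
  rewrite inE => -[m _ xS]; apply: le_trans (limit_value_le m.+1 s x) _.
  by rewrite stage_valueS mem_set.
have {}xS : ~ limit_set x by move/mem_set; exact/negP.
apply: le_trans (limit_value_le_integral s xS) _.
have [mh _] := hitting_value_regular n s.+1 measurable_limit_set.
apply: le_kernel_integral => //; first exact: measurable_limit_value.
exact: limit_value_ge0.
Qed.

(** Where the stage recursion is forced to stop, [S] stops too; elsewhere its maximum covers
    whichever choice [S] makes. Only stages below [n] have to lie in [S], so the bound is available
    while proving by induction that stages lie in [S]. *)
Lemma hitting_value_le_stage n S s x : measurable S ->
  (forall m, (m < n)%N -> stage_set m `<=` S) ->
  hitting_value n S s x <= stage_value n s x.
Proof.
move=> mS; elim: n s x => [//|n IH] s x sub.
rewrite stage_valueS [leLHS]/=.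
have [xSn|xSn] := boolP (x \in stage_set n).
  rewrite ifT//; rewrite inE in xSn; rewrite inE.
  exact: sub (ltnSn n) _ xSn.
case: ifPn => xS; first by rewrite le_max lexx.
rewrite le_max; apply/orP; right.
have [mh bh] := hitting_value_regular n s.+1 mS.
have [_ /(_ s.+1)[mg _]] := stage_regular n.
apply: le_kernel_integral => //; first by move=> y; case/andP: (bh y).
by move=> y; apply: IH => m mn; apply: sub; rewrite ltnS ltnW.
Qed.

Lemma hitting_integral_le_stage n S x : measurable S ->
  (forall m, (m < n)%N -> stage_set m `<=` S) ->
  \int[Q x]_y hitting_value n S 1 y <= \int[Q x]_y stage_value n 1 y.
Proof.
move=> mS sub.
have [mh bh] := hitting_value_regular n 1 mS.
have [_ /(_ 1%N)[mg _]] := stage_regular n.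
apply: le_kernel_integral => //; first by move=> y; case/andP: (bh y).
by move=> y; exact: hitting_value_le_stage.
Qed.

End stopping_values.

(** * The Markov identity extended from sets to functions *)

Section markov_integral.
Local Open Scope ereal_scope.
Context {R : realType} {d d' : measure_display}.
Context {Omega : measurableType d'} {E : measurableType d}.
Import HBNNSimple.

(** The hypothesis is the case of an indicator [g]. Linearity gives simple functions, and monotone
    convergence, applied to the inner and the outer integral, gives all nonnegative measurable
    [g]. *)
Lemma integral_disintegration (Q : R.-pker E ~> E)
    (mu : {measure set Omega -> \bar R}) (A : set Omega) (Y Z : Omega -> E)
    (g : E -> \bar R) :
  measurable A -> measurable_fun setT Y -> measurable_fun setT Z ->
  (forall B, measurable B ->
    mu (A `&` Z @^-1` B) = \int[mu]_(w in A) Q (Y w) B) ->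
  measurable_fun setT g -> (forall y, 0 <= g y) ->
  \int[mu]_(w in A) g (Z w) = \int[mu]_(w in A) \int[Q (Y w)]_y g y.
Proof.
move=> mA mY mZ QZ mg g0.
have mQ B : measurable B -> measurable_fun A (fun w => Q (Y w) B).
  move=> mB; apply: (@measurable_funS _ _ _ _ setT) => //.
  exact: measurableT_comp (measurable_kernel Q B mB) mY.
have nnsfun_case (h : {nnsfun E >-> R}) :
    \int[mu]_(w in A) (h (Z w))%:E =
    \int[mu]_(w in A) \int[Q (Y w)]_y (h y)%:E.
  under eq_integral do rewrite fimfunE -fsumEFin//.
  rewrite ge0_integral_fsum//; last 2 first.
  - move=> r; apply/measurable_EFinP; apply: (@measurable_funS _ _ _ _ setT) => //.
    by apply: measurableT_comp => //; exact: measurableT_comp.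
  - by move=> r z _; rewrite EFinM nnfun_muleindic_ge0.
  under [in RHS]eq_integral.
    move=> w _.
    under eq_integral do rewrite fimfunE -fsumEFin//.
    rewrite /= ge0_integral_fsum//; last 2 first.
    - by move=> r; exact/measurable_EFinP/measurableT_comp.
    - by move=> r z _; rewrite EFinM nnfun_muleindic_ge0.
    under eq_fsbigr.
      move=> r _.
      rewrite (integralZl_indic _ (fun r => h @^-1` [set r]))//; last first.
        by move=> r0; rewrite preimage_nnfun0.
      rewrite integral_indic// setIT.
      over.
    over.
  rewrite /= ge0_integral_fsum//; last 2 first.
  - by move=> r; apply: measurable_funeM; exact: mQ.
  - move=> r w _.
    have := mulemu_ge0 (fun r => h @^-1` [set r]).
    by apply; exact: preimage_nnfun0.
  apply: eq_fsbigr => r _.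
  rewrite (integralZl_indic mA (fun r => Z @^-1` (h @^-1` [set r])))//; last 2 first.
  - by move=> r0; rewrite preimage_nnfun0// preimage_set0.
  - by rewrite -[X in measurable X]setTI; exact: mZ.
  rewrite integral_indic//; last first.
    by rewrite -[X in measurable X]setTI; exact: mZ.
  rewrite setIC QZ//.
  (* A scalar leaves the integral only if it is nonnegative; for negative [r] the level set of the
     nonnegative [h] is empty and both sides vanish. *)
  have [r0|r0] := leP 0%R r.
    by rewrite ge0_integralZl//; exact: mQ.
  rewrite !integral0_eq ?mule0//.
    by move=> w _; rewrite preimage_nnfun0// measure0 mule0.
  by move=> w _; rewrite preimage_nnfun0// measure0.
pose h := nnsfun_approx measurableT mg.
have hg y : limn (fun n => (h n y)%:E) = g y.
  by apply/cvg_lim => //; exact: cvg_nnsfun_approx.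
have hnd y : nondecreasing_seq (fun n => (h n y)%:E).
  by move=> m n mn; rewrite lee_fin; exact/lefP/nd_nnsfun_approx.
have mh n : measurable_fun setT (fun y => (h n y)%:E) by exact/measurable_EFinP.
transitivity (\int[mu]_(w in A) limn (fun n => (h n (Z w))%:E)).
  by apply: eq_integral => w _; rewrite hg.
rewrite monotone_convergence//; last 2 first.
- move=> n; apply: (@measurable_funS _ _ _ _ setT) => //.
  exact: (measurableT_comp (mh n) mZ).
- by move=> n w _; rewrite lee_fin.
transitivity (\int[mu]_(w in A) limn (fun n => \int[Q (Y w)]_y (h n y)%:E)).
  rewrite monotone_convergence//.
  - by congr (limn _); apply/funext => n; exact: nnsfun_case.
  - move=> n; apply: (@measurable_funS _ _ _ _ setT) => //.
    apply: (measurableT_comp (f := fun x => \int[Q x]_y (h n y)%:E) _ mY).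
    apply: measurable_fun_integral_kernel => //.
      by move=> U mU; exact: measurable_kernel.
    by move=> y; rewrite lee_fin.
  - by move=> n w _; apply: integral_ge0 => y _; rewrite lee_fin.
  - move=> w _ m n mn; apply: ge0_le_integral => //.
      by move=> y _; rewrite lee_fin.
    by move=> y _; exact: hnd.
apply: eq_integral => w _; rewrite -monotone_convergence//.
- by apply: eq_integral => y _; rewrite hg.
- by move=> n y _; rewrite lee_fin.
Qed.

End markov_integral.

(** * Decomposition of the path space by the first visit to a set *)

Section hitting_time.
Context {R : realType} {d d' : measure_display}.
Context {Omega : measurableType d'} {E : measurableType d}.
Variables (X : nat -> Omega -> E) (delta : nat -> R) (f : E -> R) (S : set E).

(** The shift by one is there because [rho] disregards time 0: the event concerns times 1 to [t],
    and a first hit of index [t] occurs at time [t.+1]. *)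
Definition unhit (t : nat) : set Omega :=
  [set w | forall s, (s < t)%N -> ~ S (X s.+1 w)].

Definition first_hit (t : nat) : set Omega := unhit t `&` X t.+1 @^-1` S.

Lemma unhit0 : unhit 0 = setT.
Proof. by apply/seteqP; split. Qed.

Lemma unhitS t : unhit t.+1 = unhit t `\` X t.+1 @^-1` S.
Proof.
apply/seteqP; split=> [w Uw|w [Uw St] s].
  by split=> [s st|]; apply: Uw => //; exact: ltnW.
by rewrite ltnS leq_eqVlt => /orP[/eqP ->//|]; exact: Uw.
Qed.

Variant rho_spec (w : Omega) : option nat -> Prop :=
| RhoHit t of first_hit t w : rho_spec w (Some t.+1)
| RhoNever of (forall t, unhit t w) : rho_spec w None.

Lemma rhoP w : rho_spec w (rho X S w).
Proof.
rewrite /rho; case: pselect => [h|nh].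
  case: ex_minnP => -[//|t] /andP[_ St] mint; constructor; split.
    move=> s st Ss; have := mint s.+1; rewrite (mem_set Ss) => /(_ isT).
    by rewrite ltnS leqNgt st.
  exact: set_mem.
constructor=> t s _ Ss; apply: nh; exists s.+1.
exact: mem_set.
Qed.

Lemma discounted_reward_first_hit t w : first_hit t w ->
  discounted_reward X delta f S w = delta t.+1 * f (X t.+1 w).
Proof.
rewrite /discounted_reward => -[Ut St]; case: rhoP => [s [Us Ss]|U].
  case: (ltngtP s t) => [st|ts|->//]; first by case: (Ut s).
  by case: (Us t).
by case: (U t.+1 t).
Qed.

Lemma discounted_reward_never w : (forall t, unhit t w) ->
  discounted_reward X delta f S w = 0.
Proof.
rewrite /discounted_reward => U; case: rhoP => // s [Us Ss].
by case: (U s.+1 s).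
Qed.

Hypothesis mX : forall t, measurable_fun setT (X t).
Hypothesis mS : measurable S.
Hypothesis mf : measurable_fun setT f.

(** This makes the event admissible as conditioning event in the Markov property at time [t]. *)
Lemma unhit_filtration t : natural_filtration X t (unhit t).
Proof.
elim: t => [|t IH]; first by rewrite unhit0; exact: (@measurableT _ (g_sigma_algebraType _)).
rewrite unhitS.
apply: (@measurableD _ (g_sigma_algebraType _)).
  apply: sub_sigma_algebra2 IH => A [s /= st XA].
  by exists s => //=; exact: leqW.
apply: sub_sigma_algebra; exists t.+1 => //=.
by exists S => //; rewrite setTI.
Qed.

Lemma measurable_preimage t (B : set E) : measurable B ->
  measurable (X t @^-1` B).
Proof. by move=> mB; rewrite -[X in measurable X]setTI; exact: mX. Qed.

Lemma measurable_unhit t : measurable (unhit t).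
Proof.
elim: t => [|t IH]; first by rewrite unhit0.
by rewrite unhitS; apply: measurableD => //; exact: measurable_preimage.
Qed.

Lemma measurable_first_hit t : measurable (first_hit t).
Proof.
by apply: measurableI; [exact: measurable_unhit|exact: measurable_preimage].
Qed.

(** The path space splits into the countably many first-hit events and the event of no visit; on
    each piece the reward has an explicit measurable formula. *)
Lemma measurable_discounted_reward :
  measurable_fun setT (discounted_reward X delta f S).
Proof.
have -> : [set: Omega] = \bigcup_t first_hit t `|` \bigcap_t unhit t.
  apply/esym; apply/seteqP; split=> // w _.
  by have [t Ht|U] := rhoP w; [left; exists t|right=> t _; exact: U].
apply/measurable_funU.
- by apply: bigcupT_measurable => t; exact: measurable_first_hit.
- by apply: bigcapT_measurable => t; exact: measurable_unhit.
split.
  apply/measurable_fun_bigcup => [t|t]; first exact: measurable_first_hit.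
  apply: (eq_measurable_fun (fun w => delta t.+1 * f (X t.+1 w))).
    by move=> w; rewrite inE => Hw; rewrite (discounted_reward_first_hit Hw).
  apply: (@measurable_funS _ _ _ _ setT) => //.
  by apply: measurable_funM => //; exact: measurableT_comp.
apply: (eq_measurable_fun (cst (0 : R))); last exact: measurable_cst.
by move=> w; rewrite inE => Uw; rewrite discounted_reward_never// => t; exact: Uw.
Qed.

Local Open Scope ereal_scope.

Lemma integral_unhitS (mu : {measure set Omega -> \bar R}) t
    (g : Omega -> \bar R) :
  measurable_fun setT g -> (forall w, 0 <= g w) ->
  \int[mu]_(w in unhit t) g w =
  \int[mu]_(w in first_hit t) g w + \int[mu]_(w in unhit t.+1) g w.
Proof.
move=> mg g0.
rewrite -[in LHS](setUIDK (unhit t) (X t.+1 @^-1` S)) -unhitS -/(first_hit t).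
rewrite ge0_integral_setU//.
- exact: measurable_first_hit.
- exact: measurable_unhit.
- exact: measurable_funS mg.
- rewrite unhitS; apply/disj_set2P; apply/seteqP; split=> // w [[_ Sw] [_ +]].
  by apply.
Qed.

End hitting_time.

(** * Continuation values as limits of truncated hitting values *)

Section continuation.
Local Open Scope ereal_scope.
Context {R : realType} {d d' : measure_display}.
Context {Omega : measurableType d'} {E : measurableType d}.
Variables (Q : R.-pker E ~> E) (delta : nat -> R) (f : E -> R) (M : R).
Variables (P : E -> probability Omega R) (X : nat -> Omega -> E).
Hypothesis delta_discount : discount_function delta.
Hypothesis PX_markov : markov_family Q P X.
Hypothesis mf : measurable_fun setT f.
Hypothesis f0 : forall x, (0 <= f x)%R.
Hypothesis fM : forall x, (f x <= M)%R.
Hypothesis M0 : (0 <= M)%R.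
Variable (S : set E).
Hypothesis mS : measurable S.

Local Notation h := (hitting_value Q delta f M).
Local Notation D := (discounted_reward X delta f S).

Let mX t : measurable_fun setT (X t).
Proof. by case: PX_markov. Qed.

Let mD : measurable_fun setT (EFin \o D).
Proof. by apply/measurable_EFinP; exact: measurable_discounted_reward. Qed.

Lemma discounted_reward_ge0 w : 0 <= (D w)%:E.
Proof.
have [d01 _ _ _ _] := delta_discount.
rewrite lee_fin /discounted_reward; case: rho => // t.
by rewrite mulr_ge0//; case/andP: (d01 t).
Qed.

(** A visit can then occur no earlier than time [t.+1], and [delta] decreases; without any visit the
    reward is zero. *)
Lemma discounted_reward_unhit t w : unhit X S t w ->
  (D w <= M * delta t.+1)%R.
Proof.
have [d01 dd _ _ _] := delta_discount => Ut.
have d0 s : (0 <= delta s)%R by case/andP: (d01 s).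
rewrite /discounted_reward; case: rhoP => [s [Us Ss]|_]; last exact: mulr_ge0.
rewrite mulrC ler_pM//; apply: dd; rewrite ltnS leqNgt.
by apply/negP => st; exact: (Ut s).
Qed.

Let mh n s : measurable_fun setT (h n S s).
Proof. by case: (hitting_value_regular Q delta_discount mf f0 fM M0 n s mS). Qed.

Let bh n s x : 0 <= h n S s x <= (M * delta s)%:E.
Proof. by case: (hitting_value_regular Q delta_discount mf f0 fM M0 n s mS). Qed.

Let h0 n s x : 0 <= h n S s x.
Proof. by case/andP: (bh n s x). Qed.

Let mhX n s t : measurable_fun setT (fun w => h n S s (X t w)).
Proof. exact: measurableT_comp. Qed.

(** The true reward [reward] and its truncation [value] both decompose as [gain] plus a term at
    [t.+1], so comparing them reduces to [n = 0]. *)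
Let value (x : E) n t :=
  \int[P x]_(w in unhit X S t) h n S t.+1 (X t.+1 w).

Let reward (x : E) t := \int[P x]_(w in unhit X S t) (D w)%:E.

Let gain (x : E) t :=
  \int[P x]_(w in first_hit X S t) (delta t.+1 * f (X t.+1 w))%:E.

Let reward_split x t : reward x t = gain x t + reward x t.+1.
Proof.
rewrite /reward (integral_unhitS mX mS)//; last exact: discounted_reward_ge0.
congr (_ + _); apply: eq_integral => w; rewrite inE => Hw.
by rewrite (discounted_reward_first_hit _ _ Hw).
Qed.

(** On the first-hit event the hitting value is the payoff. On the rest it is a kernel integral at
    [X t.+1], which the Markov property at time [t.+1] turns into a function of [X t.+2]. *)
Let value_split x n t : value x n.+1 t = gain x t + value x n t.+1.
Proof.
rewrite /value (integral_unhitS mX mS)//; congr (_ + _).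
  by apply: eq_integral => w; rewrite inE => -[_ Sw] /=; rewrite mem_set.
transitivity (\int[P x]_(w in unhit X S t.+1)
    \int[Q (X t.+1 w)]_y h n S t.+2 y).
  apply: eq_integral => w; rewrite inE unhitS => -[_ Sw] /=.
  by rewrite memNset.
apply/esym; apply: integral_disintegration => //.
  exact: measurable_unhit.
move=> B mB; have [_ /(_ x)[_]] := PX_markov; apply=> //.
exact: unhit_filtration.
Qed.

Let reward_le_value x n t : reward x t <= value x n t.
Proof.
elim: n t => [|n IH] t.
  apply: ge0_le_integral => //.
  - exact: measurable_unhit.
  - by move=> w _; exact: discounted_reward_ge0.
  - exact: measurable_funS mD.
  - by move=> w Uw; rewrite lee_fin; exact: discounted_reward_unhit.
by rewrite reward_split value_split leeD2l.
Qed.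

(** Each split trades one unit of [n] for one of [t], so [n + t] is preserved and the error is the
    bound placed at the truncation time. *)
Let value_le_reward x n t : value x n t <= reward x t + (M * delta (n + t).+1)%:E.
Proof.
have [d01 _ _ _ _] := delta_discount.
elim: n t => [|n IH] t.
  rewrite /value /= (integral_cst (P x) (measurable_unhit mX mS t)).
  apply: (@le_trans _ _ (M * delta t.+1)%:E).
    rewrite -[leRHS]mule1 lee_wpmul2l//.
      by rewrite lee_fin mulr_ge0//; case/andP: (d01 t.+1).
    by apply: probability_le1; exact: measurable_unhit.
  by rewrite add0n leeDr//; apply: integral_ge0 => w _; exact: discounted_reward_ge0.
rewrite reward_split value_split -addeA leeD2l//.
by rewrite addSnnS; exact: IH.
Qed.

Let reward0 x : reward x 0 = continuation_value P X delta f S x.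
Proof. by rewrite /reward unhit0 /continuation_value unlock. Qed.

(** The Markov property at time 0 yields the kernel at [X 0], which is almost surely [x]. *)
Let value0 x n : value x n 0 = \int[Q x]_y h n S 1 y.
Proof.
have [_ /(_ x)[X0 mk]] := PX_markov.
rewrite /value (@integral_disintegration _ _ _ _ _ Q _ _ (X 0))//; first last.
- by move=> B mB; apply: mk => //; exact: unhit_filtration.
- exact: measurable_unhit.
rewrite unhit0.
transitivity (\int[P x]_w cst (\int[Q x]_y h n S 1 y) w); last first.
  rewrite integral_cst// [X in _ * X](_ : _ = 1) ?mule1//.
  exact: probability_setT.
have mI : measurable_fun setT (fun z => \int[Q z]_y h n S 1 y).
  exact: measurable_kernel_integral.
apply: ge0_ae_eq_integral => //.
- exact: (measurableT_comp mI (mX 0)).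
- by move=> w _; exact: integral_ge0.
- by move=> w _; exact: integral_ge0.
- by apply: filterS X0 => w /= ->.
Qed.

Lemma continuation_le_hitting n x :
  continuation_value P X delta f S x <= \int[Q x]_y h n S 1 y.
Proof. by rewrite -reward0 -value0; exact: reward_le_value. Qed.

(** The truncation error [M * delta n.+1] tends to 0 because [delta] does. *)
Lemma le_continuation x (c : \bar R) :
  (forall n, c <= \int[Q x]_y h n S 1 y) ->
  c <= continuation_value P X delta f S x.
Proof.
have [_ _ _ _ dlim] := delta_discount.
move=> ch; rewrite -reward0 -[leRHS]adde0.
have lim : (fun n => reward x 0 + (M * delta n.+1)%:E) @ \oo --> reward x 0 + 0.
  apply: cvgeD => //; first by rewrite fin_num_adde_defl.
    exact: cvg_cst.
  apply/cvg_EFin; first exact: nearW.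
  rewrite -(mulr0 M); apply: cvgMr.
  by rewrite (cvg_shiftS delta).
rewrite -(cvg_lim _ lim)//; apply: lime_ge; first by apply/cvg_ex; eexists; exact: lim.
apply: nearW => n; apply: le_trans (ch n) _.
by rewrite -value0 -[n in delta n.+1]addn0; exact: value_le_reward.
Qed.

End continuation.

(** * The limit set as smallest and optimal equilibrium *)

Section equilibria.
Local Open Scope ereal_scope.
Context {R : realType} {d d' : measure_display}.
Context {Omega : measurableType d'} {E : measurableType d}.
Variables (Q : R.-pker E ~> E) (delta : nat -> R) (f : E -> R) (M : R).
Variables (P : E -> probability Omega R) (X : nat -> Omega -> E).
Hypothesis delta_discount : discount_function delta.
Hypothesis delta_supermul :
  forall s t : nat, (delta s * delta t <= delta (t + s)%N)%R.
Hypothesis PX_markov : markov_family Q P X.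
Hypothesis mf : measurable_fun setT f.
Hypothesis f0 : forall x, (0 <= f x)%R.
Hypothesis fM : forall x, (f x <= M)%R.
Hypothesis M0 : (0 <= M)%R.

Local Notation stage_set := (stage_set Q delta f M).
Local Notation stage_value := (stage_value Q delta f M).
Local Notation limit_set := (limit_set Q delta f M).
Local Notation limit_value := (limit_value Q delta f M).
Local Notation C := (continuation_value P X delta f).

Let mL : measurable limit_set.
Proof. exact: measurable_limit_set. Qed.

Let le_hitting S n x : measurable S ->
  C S x <= \int[Q x]_y hitting_value Q delta f M n S 1 y.
Proof. by move=> mS; exact: continuation_le_hitting. Qed.

(** A newly added point outside [S] would have [f x] at most the continuation value of [S], hence at
    most the stage integral, since the earlier stages already lie in [S]. This contradicts its being
    added. *)
Lemma stage_set_sub_pseudo S n :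
  pseudo_equilibria P X delta f S -> stage_set n `<=` S.
Proof.
move=> [mS eqS]; elim/ltn_ind: n => -[_ x []|n IH].
move=> x; rewrite stage_setS => -[|xlt]; first exact: IH.
apply: contrapT => xS; move: xlt; apply/negP; rewrite -leNgt.
apply: le_trans (eqS x xS) _; apply: le_trans (le_hitting n x mS) _.
by apply: hitting_integral_le_stage => // m mn; apply: IH; exact: ltnW.
Qed.

Lemma limit_set_sub_pseudo S :
  pseudo_equilibria P X delta f S -> limit_set `<=` S.
Proof. by move=> eqS x [n _ xS]; exact: stage_set_sub_pseudo eqS _ xS. Qed.

Lemma continuation_le_stage S n x : measurable S -> limit_set `<=` S ->
  C S x <= \int[Q x]_y stage_value n 1 y.
Proof.
move=> mS sub.
apply: le_trans (le_hitting n x mS) _.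
apply: hitting_integral_le_stage => // m _ y ym.
by apply: sub; exists m.
Qed.

Lemma limit_value_le_continuation x :
  \int[Q x]_y limit_value 1 y <= C limit_set x.
Proof.
apply: (le_continuation delta_discount PX_markov mf f0 fM M0 mL) => n.
have [mh _] := hitting_value_regular Q delta_discount mf f0 fM M0 n 1 mL.
apply: le_kernel_integral => //; first exact: measurable_limit_value.
  exact: limit_value_ge0.
by move=> y; exact: limit_value_le_hitting.
Qed.

(** The integral of [limit_value] at time 1 separates the two sides: stage integrals bound the left
    from above and converge down to it, while it is at most the right. *)
Lemma continuation_le_limit S x : measurable S -> limit_set `<=` S ->
  C S x <= C limit_set x.
Proof.
move=> mS sub; apply: le_trans (limit_value_le_continuation x).
by apply: le_limit_value_integral => // n; exact: continuation_le_stage.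
Qed.

Lemma reward_le_continuation_limit x : ~ limit_set x ->
  (f x)%:E <= C limit_set x.
Proof.
move=> xS; apply: le_trans (limit_value_le_continuation x).
by apply: le_limit_value_integral => // n; exact: le_stage_integral1.
Qed.

Lemma limit_set_equilibrium : equilibria P X delta f limit_set.
Proof.
split=> // [|x [n _]]; first exact: reward_le_continuation_limit.
(* The induction goes back to the stage at which [x] entered; there [f x] exceeds a stage integral,
   which bounds the continuation value. *)
elim: n => [[]|n IH]; rewrite stage_setS => -[/IH//|/ltW].
by apply: le_trans; exact: continuation_le_stage.
Qed.

Lemma equilibrium_pseudo S :
  equilibria P X delta f S -> pseudo_equilibria P X delta f S.
Proof. by case. Qed.

Lemma pseudo_equilibria_capE : pseudo_equilibria_cap P X delta f = limit_set.
Proof.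
apply/seteqP; split=> [x|x xL S eqS]; last exact: limit_set_sub_pseudo eqS _ xL.
by apply; exact/equilibrium_pseudo/limit_set_equilibrium.
Qed.

Lemma equilibria_capE : equilibria_cap P X delta f = limit_set.
Proof.
apply/seteqP; split=> [x|x xL S /equilibrium_pseudo eqS].
  by apply; exact: limit_set_equilibrium.
exact: limit_set_sub_pseudo eqS _ xL.
Qed.

(** On the limit set both sides equal [f x]. On the rest of [S] the left is [f x] and the
    equilibrium inequality applies; outside [S] two continuation values are compared. *)
Lemma J_le_limit S x : pseudo_equilibria P X delta f S ->
  J P X delta x S f <= J P X delta x limit_set f.
Proof.
move=> eqS; have sub := limit_set_sub_pseudo eqS.
rewrite /J; have [xL|xL] := boolP (x \in limit_set).
  by rewrite mem_set//; apply: sub; exact: set_mem.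
case: ifP => _; last by apply: continuation_le_limit => //; case: eqS.
by apply: reward_le_continuation_limit => /mem_set; exact/negP.
Qed.

(** Stated for a general family so as to serve both [W] and [V]. *)
Lemma sup_J_eq_limit (F : set (set E)) x :
  F `<=` pseudo_equilibria P X delta f -> F limit_set ->
  ereal_sup [set J P X delta x S f | S in F] = J P X delta x limit_set f.
Proof.
move=> sub FL; apply/eqP; rewrite eq_le; apply/andP; split.
  by apply: ge_ereal_sup => _ [S /sub eqS <-]; exact: J_le_limit.
by apply: ereal_sup_ubound; exists limit_set.
Qed.

End equilibria.

Theorem proposition4p2 (R : realType) (T : ptopologicalType)
  (polishT : polish R T)
  (delta : nat -> R) (delta_discount : discount_function delta)
  (delta_supermul : forall s t : nat, delta s * delta t <= delta (t + s)%N)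
  (Q : R.-pker borelType T ~> borelType T)
  (d : measure_display) (Omega : measurableType d)
  (P : borelType T -> probability Omega R) (X : nat -> Omega -> borelType T)
  (PX_markov : markov_family Q P X)
  (f : borelType T -> R) (f_reward : bounded_reward f) :
  (* implicit in evaluating J at this set *)
  measurable (pseudo_equilibria_cap P X delta f) /\
  pseudo_equilibria_cap P X delta f = equilibria_cap P X delta f /\
  forall x : borelType T,
    W P X delta x f = J P X delta x (pseudo_equilibria_cap P X delta f) f /\
    J P X delta x (pseudo_equilibria_cap P X delta f) f = V P X delta x f.
Proof.
have [mf f0 [M fM]] := f_reward.
(* The space is pointed, so the upper bound of a nonnegative function is itself nonnegative. *)
have M0 : 0 <= M := le_trans (f0 point) (fM point).
have mL := measurable_limit_set Q delta_discount mf f0 fM M0.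
have eqL := limit_set_equilibrium
  delta_discount delta_supermul PX_markov mf f0 fM M0.
have capE := pseudo_equilibria_capE
  delta_discount delta_supermul PX_markov mf f0 fM M0.
have supE := sup_J_eq_limit
  delta_discount delta_supermul PX_markov mf f0 fM M0.
rewrite capE; split=> //; split.
  by rewrite (equilibria_capE delta_discount delta_supermul PX_markov mf f0 fM M0).
move=> x; split; first by apply: supE => //; exact: equilibrium_pseudo.
by apply/esym/supE => // S; exact: equilibrium_pseudo.
Qed.
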